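(* Let $(A_1A_2A_3A_4,g)$ be a $(q,l)$-pair and let $\{i,j,k,s\}=\{1,2,3,4\}$. With the points $U_{pq}$, $M_{pq}^r$, $I,I',J,J',L,L'$ defined in the context, the following hold. 1) The lines $M_{ij}^kM_{ji}^s$ and $M_{ij}^sM_{ji}^k$ are incident with the point $U_{ks}$; the lines $M_{sk}^jM_{ks}^i$ and $M_{sk}^iM_{ks}^j$ are incident with the point $U_{ij}$. 2) The lines $A_iM_{ks}^j$, $A_jM_{sk}^i$, $M_{ij}^kA_s$, $M_{ji}^sA_k$, $JI$, $I'L'$ are concurrent; the lines $A_iM_{sk}^j$, $A_jM_{ks}^i$, $M_{ji}^kA_s$, $M_{ij}^sA_k$, $IL$, $J'I'$ are concurrent. 3) The lines $M_{ij}^kM_{ij}^s$, $M_{ji}^sM_{ji}^k$, $A_iA_j$, $IJ$, $I'J'$ are concurrent; the lines $M_{sk}^jM_{sk}^i$, $M_{ks}^iM_{ks}^j$, $A_sA_k$, $IL$, $I'L'$ are concurrent.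
   Context: The ambient plane is the extended Euclidean plane, i.e. the Euclidean plane complemented with its points at infinity and its line at infinity $\omega$ (a model of the real projective plane). $XY$ denotes the line joining points $X,Y$, and $a\cap b$ the intersection point of lines $a,b$. A complete quadrangle $A_1A_2A_3A_4$ is a set of four points, no three collinear, together with the six lines $A_pA_q$; its diagonal points are the three intersection points of opposite sides, $A_1A_2\cap A_3A_4$, $A_1A_3\cap A_2A_4$, $A_1A_4\cap A_2A_3$. A $(q,l)$-pair $(A_1A_2A_3A_4,g)$ consists of a complete quadrangle and a line $g$ of its plane (possibly $g=\omega$) which is not incident with any vertex $A_p$ nor with any of the diagonal points. For a $(q,l)$-pair put $U_{pq}=U_{qp}=g\cap A_pA_q$ ($p\ne q$). For the pair of vertices $A_i,A_j$ the four Sharygin's points are $M_{ij}^k=A_iU_{js}\cap A_jA_k$, $M_{ji}^s=A_jU_{ik}\cap A_iA_s$, $M_{ij}^s=A_iU_{jk}\cap A_jA_s$, $M_{ji}^k=A_jU_{is}\cap A_iA_k$, and for the pair $A_s,A_k$ they are $M_{sk}^j=A_sU_{ik}\cap A_jA_k$, $M_{ks}^i=A_kU_{js}\cap A_iA_s$, $M_{sk}^i=A_sU_{jk}\cap A_iA_k$, $M_{ks}^j=A_kU_{is}\cap A_jA_s$. Further, $I=A_iA_k\cap A_jA_s$, $I'=A_iA_s\cap A_jA_k$; $J=A_iU_{js}\cap A_jU_{ik}$, $J'=A_iU_{jk}\cap A_jU_{is}$; $L=A_kU_{js}\cap A_sU_{ik}$, $L'=A_sU_{jk}\cap A_kU_{is}$.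 Lines are concurrent if they pass through a common point (possibly at infinity). *)

(* Defs.v *)
(* MathComp world; the real numbers are an arbitrary [R : realType]. *)
From mathcomp Require Import all_boot all_order all_algebra.
From mathcomp Require Import reals.
Set Implicit Arguments.
Unset Strict Implicit.
Unset Printing Implicit Defensive.
Import GRing.Theory.

(* The extended Euclidean plane in homogeneous coordinates: the Euclidean point
   (x, y) is the span of (x, y, 1), the point at infinity in the direction
   (u, v) != 0 is the span of (u, v, 0), and the line at infinity is z = 0.
   A point is a 1-dimensional subspace of R^3 and a line a 2-dimensional one,
   so that the line joining X and Y is [(X + Y)%VS] and the intersection point
   of a and b is [(a :&: b)%VS]. *)
Definition flat (R : realType) := {vspace 'rV[R]_3}.

Definition is_point (R : realType) (X : flat R) : Prop := \dim X = 1%N.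

Definition is_line (R : realType) (a : flat R) : Prop := \dim a = 2%N.

(* Incidence includes that X and a are a genuine point and a genuine line: the
   sum of two equal points or the intersection of two equal lines does not
   qualify. *)
Definition incident (R : realType) (X a : flat R) : Prop :=
  [/\ is_point X, is_line a & (X <= a)%VS].

Definition collinear (R : realType) (X Y Z : flat R) : Prop :=
  exists a : flat R, [/\ incident X a, incident Y a & incident Z a].

Definition concurrent (R : realType) (ls : seq (flat R)) : Prop :=
  exists X : flat R, forall a : flat R, a \in ls -> incident X a.

(* The vertices A_1, ..., A_4 are indexed by 'I_4 = {0, 1, 2, 3}. *)
Definition complete_quadrangle (R : realType) (A : 'I_4 -> flat R) : Prop :=
  [/\ injective A, forall p, is_point (A p)
    & forall p q r, uniq [:: p; q; r] -> ~ collinear (A p) (A q) (A r)].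

Definition diagonal_point (R : realType) (A : 'I_4 -> flat R) (D : flat R) :
    Prop :=
  exists p q r t : 'I_4, [set p; q; r; t] = [set: 'I_4]
    /\ D = ((A p + A q) :&: (A r + A t))%VS.

Definition ql_pair (R : realType) (A : 'I_4 -> flat R) (g : flat R) : Prop :=
  [/\ complete_quadrangle A, is_line g, forall p, ~ incident (A p) g
    & forall D, diagonal_point A D -> ~ incident D g].

(* Main.v *)
Require Import Defs.
From mathcomp Require Import all_boot all_order all_algebra.
From mathcomp Require Import reals.
From mathcomp Require Import ring.
Import GRing.Theory Num.Theory.
Local Open Scope vspace_scope.

(** The incidences are polynomial identities in suitable coordinates. The
    vertices of a quadrangle form a projective frame, so A_i, A_j, A_k, A_s may
    be taken to be (1,0,0), (0,1,0), (0,0,1), (1,1,1), and g is the line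
    a x + b y + c z = 0 (ql_pair_frame). That g avoids the vertices means that
    a, b, c and a+b+c are nonzero; that it avoids the diagonal points means that
    a+b, a+c and b+c are nonzero.

    Joins and meets are cross products of coordinate triples, as long as these
    products do not vanish (join_ptE, meet_lnE). For instance
    U_js = (b,-(a+c),b), hence M_ij^k = (0,-(a+c),b), and likewise
    M_ji^s = (c,-a,-a), whose difference is U_ks = (c,c,-(a+b)). Every point and
    line of the statement is found in this way, and each cross product that
    occurs has an entry that is, up to sign, 1 or a product of the seven nonzero
    numbers above: so the position of g ensures that no join or meet collapses.

    The statement has a large symmetry. Exchanging k and s exchanges the two
    lines through U_ks in 1), the two families of lines in 2), I and I', J and
    J', L and L'. The substitution (i,j,k,s) -> (s,k,j,i) turns the pair A_i, A_j
    into the pair A_s, A_k; it fixes I and I' and turns J into L and J' into L'.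
    So only one claim of each kind is computed (sharygin_incidences). *)

Set Implicit Arguments.
Unset Strict Implicit.
Unset Printing Implicit Defensive.

(** * Homogeneous coordinates *)

Definition cross {R : realType} (u v : R * R * R) : R * R * R :=
  let: (x, y, z) := u in let: (x', y', z') := v in
  (y * z' - z * y', z * x' - x * z', x * y' - y * x')%R.

Definition dot {R : realType} (u v : R * R * R) : R :=
  let: (x, y, z) := u in let: (x', y', z') := v in
  (x * x' + y * y' + z * z')%R.

Definition scale {R : realType} (t : R) (u : R * R * R) : R * R * R :=
  let: (x, y, z) := u in (t * x, t * y, t * z)%R.

Definition vec {R : realType} (u : R * R * R) : 'rV[R]_3 :=
  let: (x, y, z) := u in (\row_p [:: x; y; z]`_p)%R.

(** Homogeneous coordinates are relative to the basis formed by the rows of M, so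
    that one may adapt them to a quadrangle. *)
Definition pt {R : realType} (M : 'M[R]_3) (u : R * R * R) : flat R :=
  <[(vec u *m M)%R]>.

(** The kernel of the linear form whose coefficients, in the basis dual to the
    rows of M, are l. *)
Definition ln {R : realType} (M : 'M[R]_3) (l : R * R * R) : flat R :=
  lker (linfun (mulmxr (invmx M *m (vec l)^T)%R) : 'Hom('rV[R]_3, 'rV[R]_1)).

Lemma vecZ (R : realType) (t : R) u : vec (scale t u) = (t *: vec u)%R.
Proof.
case: u => [[x y] z]; apply/rowP; case=> [[|[|[|?]]] ?] //; by rewrite !mxE.
Qed.

Lemma vec_surj (R : realType) (v : 'rV[R]_3) : exists u, v = vec u.
Proof.
exists (v ord0 ord0, v ord0 (inord 1), v ord0 (inord 2)).
apply/rowP => -[[|[|[|//]]] p3]; rewrite !mxE /=; congr (v _ _);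
  by apply/val_inj; rewrite /= ?inordK.
Qed.

Lemma vec_eq0 (R : realType) (u : R * R * R) :
  (vec u == 0%R) = (u == (0, 0, 0)%R).
Proof.
case: u => [[x y] z]; apply/eqP/eqP => [/rowP u0|[-> -> ->]]; last first.
  by apply/rowP => -[[|[|[|//]]] p3]; rewrite !mxE.
by congr (_, _, _);
  [have := u0 (inord 0) | have := u0 (inord 1) | have := u0 (inord 2)];
  rewrite !mxE inordK.
Qed.

Lemma vec_dot (R : realType) (u l : R * R * R) :
  (vec u *m (vec l)^T == 0)%R = (dot u l == 0%R).
Proof.
case: u l => [[x y] z] [[x' y'] z'].
set D := dot _ _; suff -> : (vec (x, y, z) *m (vec (x', y', z'))^T = D%:M)%R.
  by rewrite -scalemx1 scaler_eq0 oner_eq0 orbF.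
by rewrite [LHS]mx11_scalar !mxE !big_ord_recl big_ord0 !mxE /= addr0 addrA.
Qed.

Lemma vecM_eq0 (R : realType) (M : 'M[R]_3) u : M \in unitmx ->
  (vec u *m M == 0)%R = (u == (0, 0, 0)%R).
Proof.
by move=> uM; rewrite -vec_eq0 -[RHS](inj_eq (can_inj (mulmxK uM))) mul0mx.
Qed.

Lemma mem_ln (R : realType) (M : 'M[R]_3) u l : M \in unitmx ->
  ((vec u *m M)%R \in ln M l) = (dot u l == 0%R).
Proof. by move=> uM; rewrite memv_ker lfunE /= mulmxA mulmxK // vec_dot. Qed.

Lemma is_point_pt (R : realType) (M : 'M[R]_3) u : M \in unitmx ->
  u != (0, 0, 0)%R -> is_point (pt M u).
Proof. by move=> uM u0; rewrite /is_point dim_vline vecM_eq0 // u0. Qed.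

(** The only place where the order of the scalars matters: a nonzero sum of
    squares serves as a denominator below, in place of a case analysis on which
    coordinate is nonzero. *)
Lemma dot_neq0 (R : realType) (u : R * R * R) :
  u != (0, 0, 0)%R -> dot u u != 0%R.
Proof.
case: u => [[x y] z]; rewrite !xpair_eqE /= -!expr2.
by rewrite !paddr_eq0 ?addr_ge0 ?sqr_ge0 // !sqrf_eq0.
Qed.

Lemma is_line_ln (R : realType) (M : 'M[R]_3) l : M \in unitmx ->
  l != (0, 0, 0)%R -> is_line (ln M l).
Proof.
move=> uM l0; rewrite /is_line /ln; set f := linfun _.
have := limg_ker_dim f fullv; rewrite capfv [X in _ = X]dimvf /dim /= /dim /=.
suff -> : \dim (limg f) = 1%N by rewrite mul1n addn1 => -[].
apply/eqP; rewrite eqn_leq; apply/andP; split.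
  by apply: leq_trans (dimvS (subvf _)) _; rewrite dimvf /dim /=.
rewrite lt0n dimv_eq0; apply: contraNneq (dot_neq0 l0) => f0.
rewrite -(mem_ln _ _ uM) memv_ker -/f.
by rewrite -memv0 -f0 memv_img ?memvf.
Qed.

Lemma pt_sub_ln (R : realType) (M : 'M[R]_3) u l : M \in unitmx ->
  (pt M u <= ln M l) = (dot u l == 0%R).
Proof. by move=> uM; rewrite -memvE mem_ln. Qed.

Lemma incident_pt_ln (R : realType) (M : 'M[R]_3) u l : M \in unitmx ->
  u != (0, 0, 0)%R -> l != (0, 0, 0)%R -> dot u l = 0%R ->
  incident (pt M u) (ln M l).
Proof.
move=> uM u0 l0 ul; split; [exact: is_point_pt|exact: is_line_ln|].
by rewrite pt_sub_ln // ul.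
Qed.

(** Comes from the triple product expansion of n x (u x n). *)
Lemma cross0_scale (R : realType) (u n : R * R * R) : n != (0, 0, 0)%R ->
  cross u n = (0, 0, 0)%R -> u = scale (dot u n / dot n n)%R n.
Proof.
move/dot_neq0; case: u n => [[x y] z] [[p q] r] /= n0 [e1 e2 e3].
congr (_, _, _); apply: (mulIf n0); rewrite mulrAC divfK //.
- have -> : (x * (p * p + q * q + r * r) = (x * p + y * q + z * r) * p
    + q * (x * q - y * p) - r * (z * p - x * r))%R by ring.
  by rewrite e2 e3; ring.
- have -> : (y * (p * p + q * q + r * r) = (x * p + y * q + z * r) * q
    + r * (y * r - z * q) - p * (x * q - y * p))%R by ring.
  by rewrite e1 e3; ring.
- have -> : (z * (p * p + q * q + r * r) = (x * p + y * q + z * r) * r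
    + p * (z * p - x * r) - q * (y * r - z * q))%R by ring.
  by rewrite e1 e2; ring.
Qed.

(** With n = u x v, Cramer's rule gives
    (n.n) w = ((w x v).n) u + ((u x w).n) v + (w.n) n for every w. *)
Lemma cross_span (R : realType) (u v w : R * R * R) :
  cross u v != (0, 0, 0)%R -> dot w (cross u v) = 0%R ->
  exists s t, vec w = (s *: vec u + t *: vec v)%R.
Proof.
move=> /dot_neq0; set n := cross u v => n0 wn0.
exists (dot (cross w v) n / dot n n)%R, (dot (cross u w) n / dot n n)%R.
apply: (scalerI n0); rewrite scalerDr !scalerA ![(dot n n * _)%R]mulrC !divfK //.
apply: (addIr (dot w n *: vec n)%R); rewrite {1}wn0 scale0r addr0 {n0 wn0}/n.
case: u v w => [[x y] z] [[x' y'] z'] [[p q] r].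
by apply/rowP => -[[|[|[|//]]] p3]; rewrite !mxE /=; ring.
Qed.

Lemma scale_neq0 (R : realType) (t : R) u :
  u != (0, 0, 0)%R -> t != 0%R -> scale t u != (0, 0, 0)%R.
Proof.
by move=> u0 t0; rewrite -vec_eq0 vecZ scaler_eq0 (negbTE t0) /= vec_eq0.
Qed.

Lemma vecM_surj (R : realType) (M : 'M[R]_3) v : M \in unitmx ->
  exists u, v = (vec u *m M)%R.
Proof.
move=> uM; have [u uE] := vec_surj (v *m invmx M)%R.
by exists u; rewrite -uE mulmxKV.
Qed.

Lemma join_pt_cross (R : realType) (M : 'M[R]_3) u v : M \in unitmx ->
  cross u v != (0, 0, 0)%R -> pt M u + pt M v = ln M (cross u v).
Proof.
move=> uM uv0; apply/eqP; rewrite eqEsubv subv_add !pt_sub_ln //.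
apply/andP; split.
  by apply/andP; split; apply/eqP; case: (u) (v) => [[? ?] ?] [[? ?] ?] /=; ring.
apply/subvP => w; have [{}w ->] := vecM_surj w uM.
rewrite mem_ln // => /eqP /(cross_span uv0) [s [t ->]].
by rewrite mulmxDl -!scalemxAl memv_add // memvZ // memv_line.
Qed.

(** A vector w orthogonal to l and m satisfies
    w x (l x m) = (w.m) l - (w.l) m = 0, so it is proportional to l x m. *)
Lemma meet_ln_cross (R : realType) (M : 'M[R]_3) l m : M \in unitmx ->
  cross l m != (0, 0, 0)%R -> ln M l :&: ln M m = pt M (cross l m).
Proof.
move=> uM lm0; apply/eqP; rewrite eqEsubv subv_cap !pt_sub_ln //.
apply/andP; split; last first.
  by apply/andP; split; apply/eqP; case: (l) (m) => [[? ?] ?] [[? ?] ?] /=; ring.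
apply/subvP => w; have [{}w ->] := vecM_surj w uM.
rewrite memv_cap !mem_ln // => /andP [/eqP wl /eqP wm].
suff /(cross0_scale lm0) -> : cross w (cross l m) = (0, 0, 0)%R.
  by rewrite vecZ -scalemxAl memvZ // memv_line.
move: wl wm; case: (w) (l) (m) => [[x y] z] [[p q] r] [[p' q'] r'] /= wl wm.
congr (_, _, _).
- transitivity ((x * p' + y * q' + z * r') * p
    - (x * p + y * q + z * r) * p')%R; first by ring.
  by rewrite wl wm !mul0r subr0.
- transitivity ((x * p' + y * q' + z * r') * q
    - (x * p + y * q + z * r) * q')%R; first by ring.
  by rewrite wl wm !mul0r subr0.
- transitivity ((x * p' + y * q' + z * r') * r
    - (x * p + y * q + z * r) * r')%R; first by ring.
  by rewrite wl wm !mul0r subr0.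
Qed.

Lemma pt_scale (R : realType) (M : 'M[R]_3) (t : R) u :
  t != 0%R -> pt M (scale t u) = pt M u.
Proof.
move=> t0; rewrite /pt vecZ -scalemxAl; apply/eqP.
rewrite eqEsubv -!memvE memvZ ?memv_line //=.
by apply/vlineP; exists t^-1%R; rewrite scalerA mulVf // scale1r.
Qed.

Lemma ln_scale (R : realType) (M : 'M[R]_3) (t : R) l : M \in unitmx ->
  t != 0%R -> ln M (scale t l) = ln M l.
Proof.
move=> uM t0; apply/vspaceP => w; have [{}w ->] := vecM_surj w uM.
have dotZ : dot w (scale t l) = (t * dot w l)%R.
  by case: (w) (l) => [[? ?] ?] [[? ?] ?] /=; ring.
by rewrite !mem_ln // dotZ mulf_eq0 (negbTE t0).
Qed.

(** The factor t keeps the coordinates small: common factors of a cross product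
    are cancelled at once, once they are known not to vanish. *)
Lemma join_ptE (R : realType) (M : 'M[R]_3) (t : R) u v l : M \in unitmx ->
  l != (0, 0, 0)%R -> t != 0%R -> cross u v = scale t l ->
  pt M u + pt M v = ln M l.
Proof.
move=> uM l0 t0 uvl; rewrite join_pt_cross ?uvl ?scale_neq0 //.
exact: ln_scale.
Qed.

Lemma meet_lnE (R : realType) (M : 'M[R]_3) (t : R) l m u : M \in unitmx ->
  u != (0, 0, 0)%R -> t != 0%R -> cross l m = scale t u ->
  ln M l :&: ln M m = pt M u.
Proof.
move=> uM u0 t0 lmu; rewrite meet_ln_cross ?lmu ?scale_neq0 //.
exact: pt_scale.
Qed.

(* One entry that is a product of nonzero factors of the context suffices for a
   triple: it turns the conjunction of the equations to 0 into false. *)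
Ltac nonzero :=
  rewrite ?xpair_eqE ?mulf_eq0 ?oppr_eq0 ?oner_eq0;
  repeat match goal with H : is_true (?x != 0%R) |- _ =>
    rewrite ?(negbTE H); clear H end;
  by rewrite ?andbF.

Ltac cross_eq t := (apply: (join_ptE (t := t)) || apply: (meet_lnE (t := t)));
  [assumption | nonzero | nonzero | congr (_, _, _) => /=; ring].

(* The cross product changes sign with the order of its arguments, unlike joins
   and meets, so the sign of t need not be specified. *)
Ltac by_cross t := first [cross_eq t | cross_eq (- t)%R].

(** * Coordinates adapted to a quadrangle *)

Lemma point_span (R : realType) (X : flat R) (x : 'rV[R]_3) :
  is_point X -> x \in X -> x != 0%R -> X = <[x]>.
Proof.
move=> dX xX x0; apply/esym/eqP.
by rewrite eqEdim -memvE xX dX dim_vline x0.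
Qed.

Lemma point_subE (R : realType) (X Y : flat R) :
  is_point X -> is_point Y -> (X <= Y) = (X == Y).
Proof. by move=> dX dY; rewrite eqEdim dX dY andbT. Qed.

Lemma dim_add_point (R : realType) (V X : flat R) :
  is_point X -> ~~ (X <= V) -> \dim (V + X) = (\dim V).+1.
Proof.
move=> dX nXV; rewrite dimv_disjoint_sum ?dX ?addn1 //.
apply/eqP; rewrite -subv0; apply/subvP => x; rewrite memv_cap => /andP [xV xX].
rewrite memv0; apply: contraR nXV => x0.
by rewrite (point_span dX xX x0) -memvE.
Qed.

(** Distinctness is what makes X + Y a genuine line, the one that would contain
    all three points. *)
Lemma noncollinear_notin (R : realType) (X Y Z : flat R) :
  is_point X -> is_point Y -> is_point Z -> X != Y -> ~ collinear X Y Z ->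
  ~~ (Z <= X + Y).
Proof.
move=> dX dY dZ XY nXYZ; apply/negP => ZXY; apply: nXYZ.
have lXY : is_line (X + Y).
  by rewrite /is_line dim_add_point ?dX // point_subE // eq_sym.
by exists (X + Y); split; split=> //; rewrite ?addvSl ?addvSr.
Qed.

Lemma unit_frame (R : realType) (e1 e2 e3 : 'rV[R]_3) :
  \dim (<[e1]> + <[e2]> + <[e3]>) = 3 ->
  exists2 M : 'M[R]_3, M \in unitmx &
    forall x y z, (vec (x, y, z) *m M = x *: e1 + y *: e2 + z *: e3)%R.
Proof.
move=> dE; pose M : 'M[R]_3 := (\matrix_p [:: e1; e2; e3]`_p)%R.
have vecM x y z : (vec (x, y, z) *m M = x *: e1 + y *: e2 + z *: e3)%R.
  rewrite mulmx_sum_row !big_ord_recl big_ord0 !rowK !mxE /= addr0 addrA.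
  by [].
exists M => //; rewrite -row_full_unit -sub1mx; apply/row_subP => p.
have: row p 1%:M \in (<[e1]> + <[e2]> + <[e3]>).
  suff -> : <[e1]> + <[e2]> + <[e3]> = fullv by exact: memvf.
  by apply/eqP; rewrite eqEdim subvf dE dimvf.
case/memv_addP => _ /memv_addP [_ /vlineP [x ->] [_ /vlineP [y ->] ->]].
case=> _ /vlineP [z ->] ->; rewrite -vecM; exact: submxMl.
Qed.

Lemma line_ln (R : realType) (M : 'M[R]_3) (a : flat R) : M \in unitmx ->
  is_line a -> exists2 l : R * R * R, l != (0, 0, 0)%R & a = ln M l.
Proof.
move=> uM da; have a0 : a != 0%VS by rewrite -dimv_eq0 da.
have [u uE] := vecM_surj (vpick a) uM.
have ua : pt M u <= a by rewrite -memvE -uE memv_pick.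
have du : is_point (pt M u).
  by rewrite /is_point dim_vline -uE vpick0 a0.
have: ~~ (a <= pt M u).
  by apply/negP => /dimvS; rewrite du da.
case/subvPn => w wa; have [v vE] := vecM_surj w uM; rewrite {w}vE in wa * => vu.
have u0 : u != (0, 0, 0)%R by rewrite -(vecM_eq0 _ uM) -uE vpick0.
have uv0 : cross v u != (0, 0, 0)%R.
  apply: contraNneq vu => /(cross0_scale u0) ->.
  by rewrite vecZ -scalemxAl memvZ // memv_line.
exists (cross v u) => //; rewrite -join_pt_cross //; apply/esym/eqP.
have dv : is_point (pt M v).
  apply: is_point_pt => //; apply: contraNneq uv0 => ->; apply/eqP.
  by case: (u) => [[? ?] ?]; rewrite /= !mul0r subrr.
by rewrite eqEdim subv_add ua -memvE wa addvC dim_add_point ?du ?da // -memvE.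
Qed.

Lemma set4_uniq (i j k s : 'I_4) :
  [set i; j; k; s]%SET = [set: 'I_4]%SET -> uniq [:: i; j; k; s].
Proof.
move=> ijks; apply/card_uniqP => /=.
rewrite -[RHS](card_ord 4) -cardsT -ijks; apply: eq_card => x.
by rewrite !inE !orbA.
Qed.

(** Scaling the vectors that span three vertices so that they add up to one that
    spans the fourth gives the projective frame of the quadrangle. The diagonal
    points are then (1,1,0), (1,0,1) and (0,1,1), and the nonvanishing
    conditions say that g avoids the vertices and these points. *)
Lemma ql_pair_frame (R : realType) (A : 'I_4 -> flat R) (g : flat R)
    (i j k s : 'I_4) :
  ql_pair A g -> [set i; j; k; s]%SET = [set: 'I_4]%SET ->
  exists M : 'M[R]_3, exists a b c : R,
  [/\ M \in unitmx,
      [/\ A i = pt M (1, 0, 0)%R, A j = pt M (0, 1, 0)%R,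
          A k = pt M (0, 0, 1)%R, A s = pt M (1, 1, 1)%R & g = ln M (a, b, c)],
      [/\ a != 0, b != 0, c != 0 & a + b + c != 0]%R
    & [/\ a + b != 0, a + c != 0 & b + c != 0]%R].
Proof.
move=> [[injA ptA ncA] lg Ag Dg] ijks.
have := set4_uniq ijks; rewrite /= !inE !negb_or.
case/and4P => /and3P [ij ik is_] /andP [jk js] ks _.
have nin p q r : p != q -> p != r -> q != r -> ~~ (A r <= A p + A q).
  move=> pq pr qr; apply: noncollinear_notin; rewrite ?(inj_eq injA) //.
  by apply: ncA; rewrite /= !inE negb_or pq pr qr.
(* The decomposition e1 + e2 + e3 of a vector spanning A s along the other three
   vertices is the scaling sought: no term vanishes, as A s lies on no side
   joining two of them. *)
have: vpick (A s) \in A i + A j + A k.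
  suff -> : A i + A j + A k = fullv by exact: memvf.
  apply/eqP; rewrite eqEdim subvf dimvf.
  by rewrite !dim_add_point ?nin // ?ptA // point_subE // (inj_eq injA) eq_sym.
have As : A s = <[vpick (A s)]>.
  by apply: point_span; rewrite ?memv_pick // vpick0 -dimv_eq0 ptA.
case/memv_addP => _ /memv_addP [e1 e1i [e2 e2j ->]] [e3 e3k eE].
have nAs p q : p != q -> p != s -> q != s -> vpick (A s) \notin A p + A q.
  by move=> pq ps qs; rewrite memvE -As nin.
have e1_0 : e1 != 0%R.
  apply: contraNneq (nAs j k jk js ks) => e10.
  by rewrite eE e10 add0r memv_add.
have e2_0 : e2 != 0%R.
  apply: contraNneq (nAs i k ik is_ ks) => e20.
  by rewrite eE e20 addr0 memv_add.
have e3_0 : e3 != 0%R.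
  apply: contraNneq (nAs i j ij is_ js) => e30.
  by rewrite eE e30 addr0 memv_add.
have Ai := point_span (ptA i) e1i e1_0.
have Aj := point_span (ptA j) e2j e2_0.
have Ak := point_span (ptA k) e3k e3_0.
have [M uM vecM] : exists2 M : 'M[R]_3, M \in unitmx &
    forall x y z, (vec (x, y, z) *m M = x *: e1 + y *: e2 + z *: e3)%R.
  apply: unit_frame; rewrite -Ai -Aj -Ak.
  by rewrite !dim_add_point ?nin // ?ptA // point_subE // (inj_eq injA) eq_sym.
have {}Ai : A i = pt M (1, 0, 0)%R by rewrite /pt vecM scale1r !scale0r !addr0.
have {}Aj : A j = pt M (0, 1, 0)%R.
  by rewrite /pt vecM scale1r !scale0r addr0 add0r.
have {}Ak : A k = pt M (0, 0, 1)%R by rewrite /pt vecM scale1r !scale0r !add0r.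
have {}As : A s = pt M (1, 1, 1)%R by rewrite As eE /pt vecM !scale1r.
have [[[a b] c] l0 gE] := line_ln uM lg.
have off (u : R * R * R) : u != (0, 0, 0)%R -> ~ incident (pt M u) g ->
    dot u (a, b, c) != 0%R.
  by move=> u0 ug; apply/eqP => ul; apply: ug; rewrite gE; apply: incident_pt_ln.
have diag p q r t (u : R * R * R) : [set p; q; r; t]%SET = [set i; j; k; s]%SET ->
    u != (0, 0, 0)%R -> (A p + A q) :&: (A r + A t) = pt M u ->
    dot u (a, b, c) != 0%R.
  move=> pqrt u0 uE; apply: off u0 _; rewrite -uE; apply: Dg.
  by exists p, q, r, t; rewrite pqrt.
have simp := (mul0r, mul1r, addr0, add0r).
exists M, a, b, c; split=> //.
- split.
  + have := Ag i; rewrite Ai => /off; rewrite /= !simp; apply; nonzero.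
  + have := Ag j; rewrite Aj => /off; rewrite /= !simp; apply; nonzero.
  + have := Ag k; rewrite Ak => /off; rewrite /= !simp; apply; nonzero.
  + have := Ag s; rewrite As => /off; rewrite /= !simp; apply; nonzero.
- split.
  + have := @diag i j k s (1, 1, 0)%R erefl; rewrite /= !simp.
    apply; first nonzero; rewrite Ai Aj Ak As.
    have -> : pt M (1, 0, 0)%R + pt M (0, 1, 0)%R = ln M (0, 0, 1)%R.
      by by_cross (1 : R)%R.
    have -> : pt M (0, 0, 1)%R + pt M (1, 1, 1)%R = ln M (1, -1, 0)%R.
      by by_cross (1 : R)%R.
    by by_cross (1 : R)%R.
  + have := @diag i k j s (1, 0, 1)%R; rewrite /= !simp.
    apply; [|nonzero|rewrite Ai Aj Ak As].
      by apply/setP => x; rewrite !inE; congr orb; rewrite orbAC.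
    have -> : pt M (1, 0, 0)%R + pt M (0, 0, 1)%R = ln M (0, 1, 0)%R.
      by by_cross (1 : R)%R.
    have -> : pt M (0, 1, 0)%R + pt M (1, 1, 1)%R = ln M (1, 0, -1)%R.
      by by_cross (1 : R)%R.
    by by_cross (1 : R)%R.
  + have := @diag i s j k (0, 1, 1)%R; rewrite /= !simp.
    apply; [|nonzero|rewrite Ai Aj Ak As].
      apply/setP => x; rewrite !inE.
      by case: (x == i); case: (x == j); case: (x == k); case: (x == s).
    have -> : pt M (1, 0, 0)%R + pt M (1, 1, 1)%R = ln M (0, 1, -1)%R.
      by by_cross (1 : R)%R.
    have -> : pt M (0, 1, 0)%R + pt M (0, 0, 1)%R = ln M (1, 0, 0)%R.
      by by_cross (1 : R)%R.
    by by_cross (1 : R)%R.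
Qed.

(** * Sharygin's points *)

Lemma concurrent_sub (R : realType) (ls ls' : seq (flat R)) :
  {subset ls <= ls'} -> concurrent ls' -> concurrent ls.
Proof. by move=> sub [X XP]; exists X => a /sub; apply: XP. Qed.

Lemma concurrent_pt (R : realType) (M : 'M[R]_3) (u : R * R * R)
    (ls : seq (R * R * R)) : M \in unitmx -> u != (0, 0, 0)%R ->
  all (fun l => (l != (0, 0, 0)%R) && (dot u l == 0%R)) ls ->
  concurrent [seq ln M l | l <- ls].
Proof.
move=> uM u0 /allP lsP; exists (pt M u) => _ /mapP [l /lsP /andP [l0 ul] ->].
exact: incident_pt_ln (eqP ul).
Qed.

(** The point U_pq. *)
Definition trace (R : realType) (A : 'I_4 -> flat R) (g : flat R) p q : flat R :=
  g :&: (A p + A q).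

(** The point M_ij^k. The fourth index s is determined by the others but has to
    be named, because the line A_i U_js depends on it. *)
Definition sharygin (R : realType) (A : 'I_4 -> flat R) (g : flat R) i j k s :
    flat R :=
  (A i + trace A g j s) :&: (A j + A k).

(** One representative of each type of claim; the other claims are instances of
    these under permutations of the indices. The common points are (c,-a,b+c)
    for the first family of lines and (b,a,0) for the second. *)
Lemma sharygin_incidences (R : realType) (A : 'I_4 -> flat R) (g : flat R)
    (i j k s : 'I_4) (U := trace A g) (S := sharygin A g)
    (I := (A i + A k) :&: (A j + A s)) (I' := (A i + A s) :&: (A j + A k))
    (J := (A i + U j s) :&: (A j + U i k))
    (J' := (A i + U j k) :&: (A j + U i s))
    (L' := (A s + U j k) :&: (A k + U i s)) :
  ql_pair A g -> [set i; j; k; s]%SET = [set: 'I_4]%SET ->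
  [/\ incident (U k s) (S i j k s + S j i s k),
      concurrent [:: A i + (A k + U i s) :&: (A j + A s);
                     A j + (A s + U j k) :&: (A i + A k);
                     S i j k s + A s; S j i s k + A k; J + I; I' + L']
    & concurrent [:: S i j k s + S i j s k; S j i s k + S j i k s; A i + A j;
                     I + J; I' + J']].
Proof.
move=> Ag ijks; rewrite {}/I {}/I' {}/J {}/J' {}/L'.
have [M [a [b [c [uM [Ai Aj Ak As gE] [a0 b0 c0 abc0] [ab0 ac0 bc0]]]]]] :=
  ql_pair_frame Ag ijks.
have Aij : A i + A j = ln M (0, 0, 1)%R by rewrite Ai Aj; by_cross (1 : R)%R.
have Aik : A i + A k = ln M (0, 1, 0)%R by rewrite Ai Ak; by_cross (1 : R)%R.
have Ais : A i + A s = ln M (0, 1, -1)%R by rewrite Ai As; by_cross (1 : R)%R.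
have Ajk : A j + A k = ln M (1, 0, 0)%R by rewrite Aj Ak; by_cross (1 : R)%R.
have Ajs : A j + A s = ln M (1, 0, -1)%R by rewrite Aj As; by_cross (1 : R)%R.
have Aks : A k + A s = ln M (1, -1, 0)%R by rewrite Ak As; by_cross (1 : R)%R.
have Uik : U i k = pt M (c, 0, - a)%R.
  by rewrite /U /trace Aik gE; by_cross (1 : R)%R.
have Uis : U i s = pt M (- (b + c), a, a)%R.
  by rewrite /U /trace Ais gE; by_cross (1 : R)%R.
have Ujk : U j k = pt M (0, c, - b)%R.
  by rewrite /U /trace Ajk gE; by_cross (1 : R)%R.
have Ujs : U j s = pt M (b, - (a + c), b)%R.
  by rewrite /U /trace Ajs gE; by_cross (1 : R)%R.
have Uks : U k s = pt M (c, c, - (a + b))%R.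
  by rewrite /U /trace Aks gE; by_cross (1 : R)%R.
have Aijs : A i + U j s = ln M (0, b, a + c)%R.
  by rewrite Ai Ujs; by_cross (1 : R)%R.
have Ajik : A j + U i k = ln M (a, 0, c)%R by rewrite Aj Uik; by_cross (1 : R)%R.
have Aijk : A i + U j k = ln M (0, b, c)%R by rewrite Ai Ujk; by_cross (1 : R)%R.
have Ajis : A j + U i s = ln M (a, 0, b + c)%R.
  by rewrite Aj Uis; by_cross (1 : R)%R.
have Akis : A k + U i s = ln M (a, b + c, 0)%R.
  by rewrite Ak Uis; by_cross (1 : R)%R.
have Asjk : A s + U j k = ln M (b + c, - b, - c)%R.
  by rewrite As Ujk; by_cross (1 : R)%R.
have Sijks : S i j k s = pt M (0, - (a + c), b)%R.
  by rewrite /S /sharygin -/U Aijs Ajk; by_cross (1 : R)%R.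
have Sjisk : S j i s k = pt M (c, - a, - a)%R.
  by rewrite /S /sharygin -/U Ajik Ais; by_cross (1 : R)%R.
have Sijsk : S i j s k = pt M (b, - c, b)%R.
  by rewrite /S /sharygin -/U Aijk Ajs; by_cross (1 : R)%R.
have Sjiks : S j i k s = pt M (b + c, 0, - a)%R.
  by rewrite /S /sharygin -/U Ajis Aik; by_cross (1 : R)%R.
have Mks_j : (A k + U i s) :&: (A j + A s) = pt M (b + c, - a, b + c)%R.
  by rewrite Akis Ajs; by_cross (1 : R)%R.
have Msk_i : (A s + U j k) :&: (A i + A k) = pt M (c, 0, b + c)%R.
  by rewrite Asjk Aik; by_cross (1 : R)%R.
have I_ : (A i + A k) :&: (A j + A s) = pt M (1, 0, 1)%R.
  by rewrite Aik Ajs; by_cross (1 : R)%R.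
have I'_ : (A i + A s) :&: (A j + A k) = pt M (0, 1, 1)%R.
  by rewrite Ais Ajk; by_cross (1 : R)%R.
have J_ : (A i + U j s) :&: (A j + U i k)
    = pt M (b * c, a * (a + c), - (a * b))%R.
  by rewrite Aijs Ajik; by_cross (1 : R)%R.
have J'_ : (A i + U j k) :&: (A j + U i s)
    = pt M (b * (b + c), a * c, - (a * b))%R.
  by rewrite Aijk Ajis; by_cross (1 : R)%R.
have L'_ : (A s + U j k) :&: (A k + U i s)
    = pt M (c * (b + c), - (a * c), a * b + (b + c) * (b + c))%R.
  by rewrite Asjk Akis; by_cross (1 : R)%R.
split.
- have -> : S i j k s + S j i s k
      = ln M (a * (a + b + c), b * c, c * (a + c))%R.
    by rewrite Sijks Sjisk; by_cross (1 : R)%R.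
  by rewrite Uks; apply: incident_pt_ln => //=; [nonzero|nonzero|ring].
- have -> : A i + (A k + U i s) :&: (A j + A s) = ln M (0, b + c, a)%R.
    by rewrite Mks_j Ai; by_cross (1 : R)%R.
  have -> : A j + (A s + U j k) :&: (A i + A k) = ln M (b + c, 0, - c)%R.
    by rewrite Msk_i Aj; by_cross (1 : R)%R.
  have -> : S i j k s + A s = ln M (- (a + b + c), b, a + c)%R.
    by rewrite Sijks As; by_cross (1 : R)%R.
  have -> : S j i s k + A k = ln M (a, c, 0)%R.
    by rewrite Sjisk Ak; by_cross (1 : R)%R.
  rewrite I_ I'_ J_ L'_.
  have -> : pt M (b * c, a * (a + c), - (a * b))%R + pt M (1, 0, 1)%R
      = ln M (a, - b, - a)%R by by_cross (a + c)%R.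
  have -> : pt M (0, 1, 1)%R
      + pt M (c * (b + c), - (a * c), a * b + (b + c) * (b + c))%R
      = ln M (a + b + c, c, - c)%R by by_cross (b + c)%R.
  set ls := [:: _; _; _; _; _; _].
  have -> : ls = [seq ln M l | l <- [:: (0, b + c, a); (b + c, 0, - c);
    (- (a + b + c), b, a + c); (a, c, 0); (a, - b, - a); (a + b + c, c, - c)]%R].
    by [].
  apply: (concurrent_pt uM (u := (c, - a, b + c)%R)) => /=; first by nonzero.
  do ?[apply/andP; split] => //; try nonzero; apply/eqP; ring.
- have -> : S i j k s + S i j s k = ln M (- a, b, a + c)%R.
    by rewrite Sijks Sijsk; by_cross b.
  have -> : S j i s k + S j i k s = ln M (a, - b, b + c)%R.
    by rewrite Sjisk Sjiks; by_cross a.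
  rewrite I_ I'_ J_ J'_ Aij.
  have -> : pt M (1, 0, 1)%R + pt M (b * c, a * (a + c), - (a * b))%R
      = ln M (a, - b, - a)%R by by_cross (a + c)%R.
  have -> : pt M (0, 1, 1)%R + pt M (b * (b + c), a * c, - (a * b))%R
      = ln M (- a, b, - b)%R by by_cross (b + c)%R.
  set ls := [:: _; _; _; _; _].
  have -> : ls = [seq ln M l | l <- [:: (- a, b, a + c); (a, - b, b + c);
    (0, 0, 1); (a, - b, - a); (- a, b, - b)]%R].
    by [].
  apply: (concurrent_pt uM (u := (b, a, 0)%R)) => /=; first by nonzero.
  do ?[apply/andP; split] => //; try nonzero; apply/eqP; ring.
Qed.

Theorem theorem6 (R : realType) (A : 'I_4 -> flat R) (g : flat R)
    (hAg : ql_pair A g) (i j k s : 'I_4)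
    (hijks : [set i; j; k; s]%SET = [set: 'I_4]%SET) :
  let U p q := g :&: (A p + A q) in
  let Mij_k := (A i + U j s) :&: (A j + A k) in
  let Mji_s := (A j + U i k) :&: (A i + A s) in
  let Mij_s := (A i + U j k) :&: (A j + A s) in
  let Mji_k := (A j + U i s) :&: (A i + A k) in
  let Msk_j := (A s + U i k) :&: (A j + A k) in
  let Mks_i := (A k + U j s) :&: (A i + A s) in
  let Msk_i := (A s + U j k) :&: (A i + A k) in
  let Mks_j := (A k + U i s) :&: (A j + A s) in
  let I := (A i + A k) :&: (A j + A s) in
  let I' := (A i + A s) :&: (A j + A k) in
  let J := (A i + U j s) :&: (A j + U i k) in
  let J' := (A i + U j k) :&: (A j + U i s) in
  let L := (A k + U j s) :&: (A s + U i k) in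
  let L' := (A s + U j k) :&: (A k + U i s) in
  [/\ [/\ incident (U k s) (Mij_k + Mji_s),
          incident (U k s) (Mij_s + Mji_k),
          incident (U i j) (Msk_j + Mks_i)
        & incident (U i j) (Msk_i + Mks_j)],
      concurrent [:: A i + Mks_j; A j + Msk_i; Mij_k + A s; Mji_s + A k;
                     J + I; I' + L']
      /\ concurrent [:: A i + Msk_j; A j + Mks_i; Mji_k + A s; Mij_s + A k;
                        I + L; J' + I']
    & concurrent [:: Mij_k + Mij_s; Mji_s + Mji_k; A i + A j; I + J; I' + J']
      /\ concurrent [:: Msk_j + Msk_i; Mks_i + Mks_j; A s + A k; I + L;
                        I' + L']].
Proof.
have ijsk : [set i; j; s; k]%SET = [set: 'I_4]%SET.
  by rewrite -hijks; apply/setP => x; rewrite !inE orbAC.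
have skji : [set s; k; j; i]%SET = [set: 'I_4]%SET.
  rewrite -hijks; apply/setP => x; rewrite !inE.
  by case: (x == i); case: (x == j); case: (x == k); case: (x == s).
have skij : [set s; k; i; j]%SET = [set: 'I_4]%SET.
  by rewrite -skji; apply/setP => x; rewrite !inE orbAC.
have [h1 h2 h3] := sharygin_incidences hAg hijks.
have [k1 k2 _] := sharygin_incidences hAg ijsk.
have [l1 _ l3] := sharygin_incidences hAg skji.
have [m1 _ _] := sharygin_incidences hAg skij.
(* U p q is symmetric in p and q, so that after sorting all sums of two
   vertices the four instances agree literally with the statement. *)
pose comm := (addvC (A j) (A i), addvC (A k) (A i), addvC (A s) (A i),
  addvC (A k) (A j), addvC (A s) (A j), addvC (A s) (A k)).
move: l1 l3 m1 h1 h2 h3 k1 k2; rewrite /sharygin /trace !comm.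
rewrite [(A j + A s) :&: (A i + A k)]capvC.
rewrite [(A s + _) :&: (A k + g :&: (A j + A s))]capvC.
move=> l1 l3 m1 h1 h2 h3 k1 k2.
split; [by split | split => // | by split].
apply: concurrent_sub k2 => x; rewrite !inE.
by do ?[case/orP]; move=> ->; rewrite ?orbT.
Qed.
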